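(* Let $X$ be an ${\uparrow}{\downarrow}$-closed topologized semilattice. Then the following conditions are equivalent: (1) $X$ is complete; (2) $X$ is $w^\bullet$-compact, i.e. the weak$^\bullet$ topology $w^\bullet_X$ on $X$ is compact; (3) $X$ is chain-compact.
   Context: A semilattice is a commutative semigroup all of whose elements are idempotent; it carries the partial order $x\le y$ iff $xy=x$. A topologized semilattice is a semilattice endowed with a topology (no continuity of the operation is assumed). For $x\in X$ put ${\uparrow}x=\{y\in X:x\le y\}$ and ${\downarrow}x=\{y\in X:y\le x\}$. $X$ is ${\uparrow}{\downarrow}$-closed if for every $x\in X$ the sets ${\uparrow}x$ and ${\downarrow}x$ are closed in $X$. A chain is a subset any two elements of which are comparable. $X$ is complete if each non-empty chain $C\subset X$ has an infimum and a supremum in the poset $X$ with $\inf C\in\bar C$ and $\sup C\in\bar C$, where $\bar C$ is the closure of $C$ in $X$. $X$ is chain-compact if each closed chain in $X$ is compact. The weak$^\bullet$ topology $w^\bullet_X$ is the topology on $X$ generated by the subbase consisting of complements to closed subsemilattices of $X$. Compactness means that every open cover has a finite subcover (no Hausdorff assumption). *)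

(* Defs.v *)
From HB Require Import structures.
From mathcomp Require Import all_boot all_order.
From mathcomp Require Import all_classical topology.

Set Implicit Arguments.
Unset Strict Implicit.
Unset Printing Implicit Defensive.

Import Order.TTheory.

Local Open Scope classical_set_scope.
Local Open Scope order_scope.
Local Open Scope group_scope.

HB.mixin Record Semigroup_isSemilattice X of Semigroup X := {
  mulgSLC : commutative (fun x y : X => x * y);
  mulgSLxx : forall x : X, x * x = x
}.

#[short(type="semilatticeType")]
HB.structure Definition Semilattice :=
  {X of Semigroup X & Semigroup_isSemilattice X}.

(* No compatibility between the topology and the product is required. *)
#[short(type="topologizedSemilatticeType")]
HB.structure Definition TopologizedSemilattice :=
  {X of Semilattice X & Topological X}.

Fact semilattice_display : Order.disp_t. Proof. exact: Order.default_display. Qed.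

Section NaturalOrder.
Variable X : topologizedSemilatticeType.

Definition natural_le (x y : X) : bool := x * y == x.

Fact natural_le_refl : reflexive natural_le.
Proof. by move=> x; apply/eqP/mulgSLxx. Qed.

Fact natural_le_anti : antisymmetric natural_le.
Proof. by move=> x y /andP[/eqP xy /eqP yx]; rewrite -xy mulgSLC yx. Qed.

Fact natural_le_trans : transitive natural_le.
Proof.
by move=> y x z /eqP xy /eqP yz; apply/eqP; rewrite -xy -mulgA yz.
Qed.

Fact natural_leEmul (x y : X) : natural_le x y = (x * y == x).
Proof. by []. Qed.

HB.instance Definition _ := Order.Le_isPOrder.Build semilattice_display
  (TopologizedSemilattice.sort X)
  natural_le_refl natural_le_anti natural_le_trans.

HB.instance Definition _ := Order.POrder_Meet_isSemilattice.Build
  semilattice_display (TopologizedSemilattice.sort X)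
  (@mulgSLC X) (@mulgA X) natural_leEmul.

End NaturalOrder.

Section TopologizedSemilatticeTheory.
Variable X : topologizedSemilatticeType.

Definition up_set (x : X) : set X := [set y | x <= y].
Definition down_set (x : X) : set X := [set y | y <= x].

Definition updown_closed : Prop :=
  forall x : X, closed (up_set x) /\ closed (down_set x).

Definition chain (C : set X) : Prop := total_on C (fun x y => x <= y).

(* `infimums C` and `supremums C` have at most one element, by antisymmetry. *)
Definition complete_semilattice : Prop :=
  forall C : set X, C !=set0 -> chain C ->
    (exists2 x, infimums C x & closure C x) /\
    (exists2 x, supremums C x & closure C x).

(* `cover_compact` is compactness in terms of open covers, whereas the
   library's `compact` is phrased with filters. *)
Definition chain_compact : Prop :=
  forall C : set X, closed C -> chain C -> cover_compact C.

Definition subsemilattice (A : set X) : Prop :=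
  forall x y, A x -> A y -> A (x * y).

(* An alias of X, carrying the weak topology instead of that of X.  The empty
   set counts as a subsemilattice; its complement is the whole space, so
   this does not affect the generated topology. *)
Definition weak_bullet : Type := X.

HB.instance Definition _ := Choice.on weak_bullet.
HB.instance Definition _ :=
  isSubBaseTopological.Build weak_bullet
    [set A : set X | closed A /\ subsemilattice A] (@setC X).

Definition weak_bullet_compact : Prop := cover_compact [set: weak_bullet].

End TopologizedSemilatticeTheory.

(* Main.v *)
Require Import Defs.
From mathcomp Require Import all_boot all_order.
From mathcomp Require Import finmap all_classical topology.

(**
The proof goes round the circle: complete, weak-bullet compact, chain-compact.

The substantial step is that completeness gives compactness.  A limit of an
ultrafilter in the weak-bullet topology is a point lying in every closed
subsemilattice that belongs to the ultrafilter, so it suffices to find such a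
point for an arbitrary proper filter F
([filter_closed_subsemilattices_meet]).  By completeness and Zorn's lemma
every nonempty closed subsemilattice has a least element
([closed_subsemilattice_least]).  Let P be the set of all x such that up_set x
meets every closed subsemilattice in F.  The up_set x are themselves closed
subsemilattices, which makes P closed under suprema of chains: along a chain in
P with supremum s, the least elements of A `&` up_set c form a chain in A, and
the supremum of that chain lies in A and above s.  Take p maximal in P.  For A
a closed subsemilattice in F, the least element of A `&` up_set p is again in
P, as every closed subsemilattice B in F meets A `&` up_set p; it is above p,
hence equal to p, and so p lies in A.

Weak-bullet compactness implies chain-compactness because each closed subset of
a closed chain is a closed subsemilattice of X: on a closed chain, the original
open sets are all traces of weak-bullet open sets.

Chain-compactness implies completeness because the closure of a chain C is
still a chain ([chain_closure]), hence compact: a point of the closure common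
to the nested closed sets up_set x, for x in C, is an upper bound of C, and it
is the least one because down_set u is closed for each upper bound u.  Infima
are obtained dually.
*)

Set Implicit Arguments.
Unset Strict Implicit.
Unset Printing Implicit Defensive.

Import Order.TTheory.

Local Open Scope order_scope.
Local Open Scope group_scope.
Local Open Scope classical_set_scope.

(** Zorn's lemma inside a nonempty subset of a preordered type.  Only nonempty
    chains need a bound, since completeness says nothing about the empty one;
    leaving [R] arbitrary gives minimal as well as maximal elements. *)
Lemma Zorn_in T (R : rel T) (P : set T) :
  reflexive R -> transitive R -> P !=set0 ->
  (forall C : set T, C !=set0 -> C `<=` P -> total_on C R ->
    exists2 t, P t & forall s, C s -> R s t) ->
  exists2 t, P t & forall s, P s -> R t s -> R s t.
Proof.
move=> Rxx Rtr [p Pp] ubP.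
pose R' (u v : {x | P x}) := R (sval u) (sval v).
have [|||[t Pt] tmax] := @ZL_preorder _ (exist P p Pp) R'.
- by move=> ?; exact: Rxx.
- by move=> ? ? ?; exact: Rtr.
- move=> C Ctot; have [[c Cc]|C0] := pselect (C !=set0); last first.
    by exists (exist P p Pp) => s Cs; case: C0; exists s.
  have [|||t Pt tub] := ubP (sval @` C).
  + by exists (sval c); exists c.
  + by move=> _ [y _ <-]; exact: (svalP y).
  + by move=> _ _ [u Cu <-] [v Cv <-]; exact: Ctot.
  + by exists (exist P t Pt) => s Cs; apply: tub; exists s.
by exists t => // s Ps; exact: (tmax (exist P s Ps)).
Qed.

(** If the cover has no finite subcover, the sets missing one of its members
    have the finite intersection property, and they generate a filter
    without cluster point in [A].  No base point is assumed, as a semilattice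
    may be empty. *)
Lemma compact_cover_compact (T : topologicalType) (A : set T) :
  compact A -> cover_compact A.
Proof.
move=> cptA I D f fop Acov; apply: contrapT => nofin.
pose g i := A `&` ~` f i.
have missed (E : {fset I}) : {subset E <= D} ->
    exists2 x, A x & forall i, i \in E -> ~ f i x.
  move=> ED; apply: contrapT => noE; apply: nofin; exists E => // x Ax.
  apply: contrapT => Ex; apply: noE; exists x => // i Ei fix_.
  by apply: Ex; exists i.
have gfin : finI D g.
  by move=> E /missed[x Ax Ex]; exists x => i Ei; split=> //; exact: Ex.
have PF := finI_filter gfin.
set F := filter_from _ _ in PF.
have Fg i : D i -> F (g i).
  by move=> Di; exists (g i) => //; exact: finI_from1.
(* Membership of A in F needs some index in D; that A is not covered by the
   empty subfamily provides a point of A, and its cover an index. *)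
have [x Ax _] : exists2 x, A x & forall i, i \in (fset0 : {fset I}) -> ~ f i x.
  exact: missed.
have [i Di _] := Acov x Ax.
have FA : F A by apply: filterS (Fg i Di) => ? [].
have [p [Ap pF]] := cptA F PF FA.
have [j Dj fjp] := Acov p Ap.
have [q [[_ nq] fq]] := pF _ _ (Fg j Dj) (open_nbhs_nbhs (conj (fop j Dj) fjp)).
exact: nq.
Qed.

(** Cantor's intersection theorem: among finitely many nested sets one is
    smallest, so finitely many of the complements cannot cover [K]. *)
Lemma cover_compact_nested (T : topologicalType) (K : set T) (I : choiceType)
    (D : set I) (A : I -> set T) :
  cover_compact K -> D !=set0 -> (forall i, D i -> closed (A i)) ->
  (forall i, D i -> K `&` A i !=set0) ->
  total_on D (fun i j => A i `<=` A j) ->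
  exists2 x, K x & forall i, D i -> A i x.
Proof.
move=> cptK [i0 Di0] Acl KA Atot; apply: contrapT => noK.
have [|x Kx|E ED KE] := cptK I D (fun i => ~` A i).
- by move=> i Di; apply: closed_openC; exact: Acl.
- apply: contrapT => nx; apply: noK; exists x => // i Di.
  by apply: contrapT => nAx; apply: nx; exists i.
have [i Di iE] : exists2 i, D i & forall j, j \in E -> A i `<=` A j.
  suff least (s : seq I) : {subset s <= D} ->
      exists2 i, D i & forall j, j \in s -> A i `<=` A j by exact: least ED.
  elim: s => [|j s IHs] sD; first by exists i0 => // j; rewrite in_nil.
  have [|i Di si] := IHs; first by move=> k ks; apply: sD; rewrite inE ks orbT.
  have Dj : D j by apply/set_mem/sD; rewrite inE eqxx.
  have [ij|ji] := Atot i j Di Dj.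
    by exists i => // k; rewrite inE => /predU1P[->|/si].
  exists j => // k; rewrite inE => /predU1P[->//|/si ik].
  exact: subset_trans ik.
have [x [Kx Aix]] := KA i Di.
by have [j Ej] := KE x Kx; apply; exact: iE Aix.
Qed.

Section TopologizedSemilattice.
Variable X : topologizedSemilatticeType.
Implicit Types (x y z : X) (A C : set X).

Lemma le_mulE x y : (x <= y) = (x * y == x).
Proof. by []. Qed.

Lemma mul_lel x y : x * y <= x.
Proof. by rewrite le_mulE mulgSLC mulgA mulgSLxx. Qed.

Lemma mul_ler x y : x * y <= y.
Proof. by rewrite mulgSLC mul_lel. Qed.

Lemma subsemilattice_up x : subsemilattice (up_set x).
Proof.
move=> y z; rewrite /up_set /= !le_mulE => /eqP xy /eqP xz.
by rewrite mulgA xy xz.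
Qed.

Lemma subsemilatticeI A B :
  subsemilattice A -> subsemilattice B -> subsemilattice (A `&` B).
Proof. by move=> sA sB x y [? ?] [? ?]; split; [exact: sA|exact: sB]. Qed.

Lemma chain_subsemilattice C : chain C -> subsemilattice C.
Proof.
move=> Cch x y Cx Cy; have [] := Cch x y Cx Cy; rewrite le_mulE => /eqP.
  by move=> ->.
by rewrite mulgSLC => ->.
Qed.

(** Being comparable with x is a closed condition.  It is used twice: to make
    the points of C comparable with those of the closure, and then to make the
    points of the closure comparable with one another. *)
Lemma chain_closure C : updown_closed X -> chain C -> chain (closure C).
Proof.
move=> hX Cch.
have clU x : closed (up_set x `|` down_set x).
  by have [? ?] := hX x; exact: closedU.
have clS x : C `<=` up_set x `|` down_set x ->
    closure C `<=` up_set x `|` down_set x.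
  by move=> /closureS; rewrite -(iffLR (closure_id _) (clU x)).
have comp x y : C x -> closure C y -> (up_set x `|` down_set x) y.
  by move=> Cx; apply: clS => z Cz; have [] := Cch x z Cx Cz; [left|right].
move=> x y clx cly.
have [z Cz|xy|yx] := clS x _ y cly; [|by left|by right].
by case: (comp z x Cz clx); [right|left].
Qed.

Lemma chain_compact_complete :
  updown_closed X -> chain_compact X -> complete_semilattice X.
Proof.
move=> hX cptX C C0 Cch.
have cptC : cover_compact (closure C).
  by apply: cptX; [exact: closed_closure|exact: chain_closure].
have sub_cl A : closed A -> C `<=` A -> closure C `<=` A.
  by move=> clA /closureS; rewrite -(iffLR (closure_id _) clA).
split.
- have [|x Cx|i j Ci Cj|z clz zlb] :=
    cover_compact_nested (A := @down_set X) cptC C0.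
  + by move=> x _; have [] := hX x.
  + by exists x; split; [exact: subset_closure|exact: lexx].
  + have [ij|ji] := Cch i j Ci Cj; [left|right] => x xi; exact: le_trans xi _.
  exists z => //; split; first exact: zlb.
  by move=> l lC; apply: (sub_cl (up_set l)) clz => //; have [] := hX l.
- have [|x Cx|i j Ci Cj|z clz zub] :=
    cover_compact_nested (A := @up_set X) cptC C0.
  + by move=> x _; have [] := hX x.
  + by exists x; split; [exact: subset_closure|exact: lexx].
  + have [ij|ji] := Cch i j Ci Cj; [right|left] => x xi; exact: le_trans _ xi.
  exists z => //; split; first exact: zub.
  by move=> u uC; apply: (sub_cl (down_set u)) clz => //; have [] := hX u.
Qed.

Lemma weak_bullet_open_setC A : closed A -> subsemilattice A ->
  open (~` A : set (weak_bullet X)).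
Proof.
move=> clA sA; exists [set ~` A]; last first.
  by rewrite predeqE => x; split=> [[_ ->]|] //; exists (~` A).
move=> _ ->; exists [fset A]%fset.
  by move=> B /fset1P ->; rewrite inE.
by rewrite bigcap_fset big_seq_fset1.
Qed.

(** Convergence can be tested on the subbase. *)
Lemma weak_bullet_cvg (F : set_system X) (p : X) : Filter F ->
  (forall A, closed A -> subsemilattice A -> ~ A p -> F (~` A)) ->
  F --> (p : weak_bullet X).
Proof.
move=> FF Fp U /=; rewrite (@nbhsE (weak_bullet X)).
move=> [_ [[B sB <-] [V BV Vp] BU]].
apply: filterS BU _; apply: (@filterS _ _ _ V); first by move=> ? ?; exists V.
have /sB[D sD DV] := BV; rewrite -DV; apply: filter_bigI => A DA.
have /sD := DA; rewrite inE => -[clA sA].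
by apply: Fp => //; move: Vp; rewrite -DV => /(_ _ DA).
Qed.

Lemma weak_bullet_compact_chain_compact :
  weak_bullet_compact X -> chain_compact X.
Proof.
move=> cptX C clC Cch I D f fop Ccov.
(* A point outside C has to be put in some member of the new cover, so the
   index set must be nonempty; a point of C provides an index. *)
have [[c Cc]|C0] := pselect (C !=set0); last first.
  by exists fset0 => // x Cx; case: C0; exists x.
have [i0 Di0 _] := Ccov c Cc.
have [||E ED covE] := cptX I D (fun i => ~` (C `&` ~` f i)).
- move=> i Di; apply: weak_bullet_open_setC.
    by apply: closedI => //; apply: open_closedC; exact: fop.
  apply: chain_subsemilattice => x y [Cx _] [Cy _]; exact: Cch.
- move=> x _; have [Cx|nCx] := pselect (C x).
    by have [i Di fx] := Ccov x Cx; exists i; rewrite // setCI setCK; right.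
  by exists i0; rewrite // setCI; left.
exists E => // x Cx; have [i Ei] := covE x Logic.I.
by rewrite setCI setCK => -[]; last exists i.
Qed.

Section Complete.
Hypothesis cX : complete_semilattice X.

(** Infima of chains stay in A, so A has a minimal element; it is least because
    its product with any other element of A is in A and below it. *)
Lemma closed_subsemilattice_least A : closed A -> subsemilattice A ->
  A !=set0 -> exists2 m, A m & lbound A m.
Proof.
move=> clA sA A0.
have [|||m Am mmin] := @Zorn_in X (fun x y => y <= x) A _ _ A0.
- exact: lexx.
- by move=> y x z xy yz; exact: le_trans yz xy.
- move=> C C0 CA Cch; have [|[t [tlb _] clt] _] := cX C0.
    by move=> x y Cx Cy; have [] := Cch x y Cx Cy; [right|left].
  by exists t => //; rewrite (iffLR (closure_id _) clA); exact: closureS clt.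
exists m => // x Ax; apply: le_trans (mul_ler m x).
by apply: mmin (mul_lel m x); exact: sA.
Qed.

(** A filter provides exactly what the argument asks of a family of closed
    subsemilattices: stability under binary intersection and nonempty members.
    The point is a maximal element of P. *)
Lemma filter_closed_subsemilattices_meet (F : set_system X) :
  updown_closed X -> ProperFilter F ->
  exists p, forall A, closed A -> subsemilattice A -> F A -> A p.
Proof.
move=> hX PF.
(* Membership in P says that up_set x is compatible with F. *)
pose P := [set x | forall A, closed A -> subsemilattice A -> F A ->
  A `&` up_set x !=set0].
have leastI A x : P x -> closed A -> subsemilattice A -> F A ->
    exists2 m, (A `&` up_set x) m & lbound (A `&` up_set x) m.
  move=> Px clA sA FA; apply: closed_subsemilattice_least; last exact: Px.
    by apply: closedI => //; have [] := hX x.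
  exact: subsemilatticeI sA (@subsemilattice_up x).
have P0 : P !=set0.
  have [|||m _ mlb] := @closed_subsemilattice_least setT.
  - exact: closedT.
  - by [].
  - exact: filter_ex (@filterT _ F _).
  - by exists m => A _ _ /filter_ex[a Aa]; exists a; split=> //; exact: mlb.
have [|||p Pp pmax] := @Zorn_in X (fun x y => x <= y) P _ _ P0.
- exact: lexx.
- by move=> y x z; exact: le_trans.
- move=> C C0 CP Cch; have [//|_ [s [sub slub] _]] := cX C0.
  exists s => // A clA sA FA.
  (* The least elements of the traces on A of the sets up_set c. *)
  pose D := [set y | exists2 c, C c &
    (A `&` up_set c) y /\ lbound (A `&` up_set c) y].
  have Dc c : C c -> exists2 y, D y & c <= y.
    move=> Cc; have [y Acy ylb] := leastI A c (CP c Cc) clA sA FA.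
    by exists y; [exists c|case: Acy].
  have D0 : D !=set0 by have [c /Dc[y Dy _]] := C0; exists y.
  have Dch : chain D.
    move=> y z [c Cc [[Ay cy] ylb]] [d Cd [[Az dz] zlb]].
    have [cd|dc] := Cch c d Cc Cd; [left; apply: ylb|right; apply: zlb].
      by split=> //; exact: le_trans cd dz.
    by split=> //; exact: le_trans dc cy.
  have [_ [t [tub _] clt]] := cX D0 Dch.
  exists t; split.
    rewrite (iffLR (closure_id _) clA); apply: closureS clt.
    by move=> y [c _ [[]]].
  by apply: slub => c /Dc[y Dy cy]; exact: le_trans cy (tub y Dy).
exists p => A clA sA FA.
have [m [Am pm] mlb] := leastI A p Pp clA sA FA.
suff Pm : P m by rewrite (le_anti (_ : p <= m <= p)) // pm pmax.
move=> B clB sB FB.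
have [|||x [[Ax Bx] px]] := Pp (A `&` B).
- exact: closedI.
- exact: subsemilatticeI.
- exact: filterI.
by exists x; split=> //; apply: mlb.
Qed.

Lemma complete_weak_bullet_compact : updown_closed X -> weak_bullet_compact X.
Proof.
move=> hX; apply: compact_cover_compact; rewrite compact_ultra => F UF _.
have PF : @ProperFilter X F by exact: ultra_proper.
have [p pF] := filter_closed_subsemilattices_meet hX PF.
exists p; split=> //; apply: weak_bullet_cvg => A clA sA nAp.
by have [/(pF A clA sA)|] := in_ultra_setVsetC A UF.
Qed.

End Complete.
End TopologizedSemilattice.

Theorem theorem5p6 (X : topologizedSemilatticeType) (hX : updown_closed X) :
  (complete_semilattice X <-> weak_bullet_compact X) /\
  (weak_bullet_compact X <-> chain_compact X).
Proof.
have c12 cX := @complete_weak_bullet_compact X cX hX.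
have c23 := @weak_bullet_compact_chain_compact X.
have c31 := chain_compact_complete hX.
by split; split=> // ?; [exact/c31/c23|exact/c12/c31].
Qed.
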